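(* Let $e\in\mathbb{Z}$ with $e\notin\{-1,0,1\}$. Let $\alpha\in\mathrm{S}_n$ be a permutation with $\mathrm{type}(\alpha)=\langle g_1,g_2,\ldots,g_n\rangle$ such that $g_1=0$ and $\gcd(a,b)=1$ for all $1\leq a<b\leq n$ with $g_a\neq 0\neq g_b$ (two different cycle lengths are relatively prime). Let $w=\mathrm{ord}(\alpha)=\operatorname{lcm}\{a\mid 1\leq a\leq n,\ g_a\neq 0\}$ be the order of $\alpha$. Assume that $1\leq g_a\leq q(e,w)-1$ and $\gcd(a,e^{a}-1)=1$ hold for all $1\leq a\leq n$ with $g_a\neq 0$ (i.e. for all cycle lengths of $\alpha$). If $y\in\mathrm{S}_n$ is a solution of $\alpha\circ y\circ\alpha^{-1}=y^{e}$, then $y^{e-1}=1$ and $\alpha\circ y=y\circ\alpha$. On the other hand, if $y\in\mathrm{S}_n$ is a permutation with $y^{e-1}=1$ and $\alpha\circ y=y\circ\alpha$, then $y$ is a solution of $\alpha\circ y\circ\alpha^{-1}=y^{e}$.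
   Context: $\mathrm{S}_n$ is the symmetric group of all bijections $\{1,2,\ldots,n\}\to\{1,2,\ldots,n\}$ under composition $\circ$, with identity $1$. The type of $\pi\in\mathrm{S}_n$ is the sequence $\mathrm{type}(\pi)=\langle t_1,\ldots,t_n\rangle$, where $t_i\geq 0$ is the number of cycles of $\pi$ of length $i$ (fixed points are cycles of length $1$). For an integer $v\geq 2$ with $\gcd(v,e-1)=1$, $q(e,v)$ denotes the smallest prime divisor of $e^{v}-1$ not dividing $e-1$; if there is no such prime, then $q(e,v)=+\infty$. (Under the hypothesis $\gcd(a,e^{a}-1)=1$ for all cycle lengths $a$ of $\alpha$ one has $\gcd(w,e-1)=1$, so $q(e,w)$ is defined.) *)

(* Defs.v *)
From HB Require Import structures.
From mathcomp Require Import all_boot all_order all_algebra all_fingroup.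
From mathcomp Require Import constructive_ereal.

Set Implicit Arguments.
Unset Strict Implicit.
Unset Printing Implicit Defensive.

Import Order.TTheory GRing.Theory Num.Theory.

Definition expgz (gT : finGroupType) (x : gT) (k : int) : gT :=
  match k with
  | Posz m => (x ^+ m)%g
  | Negz m => (x ^- m.+1)%g
  end.

(* Fixed points count as cycles of length 1: their [porbit] is a singleton. *)
Definition ncycles (n : nat) (s : 'S_n) (a : nat) : nat :=
  #|[set c in porbits s | #|c| == a]|.

Local Open Scope ring_scope.

(* A minimum over an empty range is [+oo]. As [primes 0 = [::]], this has its
   intended meaning only if [e ^+ v != 1]; that is automatic when [2 <= v] and
   [coprimez v (e - 1)], and also when [e] is not -1, 0, 1 and [0 < v]. *)
Definition minprime (e : int) (v : nat) : \bar int :=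
  \big[Order.min/+oo%E]_(p <- primes `|e ^+ v - 1|%N | ~~ (p%:Z %| e - 1)%Z)
    (p%:Z)%:E.

(* Main.v *)
(** Write a for the length of the alpha-cycle of a point. Replacing e by a
    natural number E congruent to it mod n! ord(y), alpha permutes the y-cycles, and the first
    power alpha^k stabilizing a y-cycle of length l acts on it as an affine map
    m |-> E^k m + c of Z/lZ. Coprimality of a and E^a - 1 gives this map a fixed
    point, whose alpha-cycle therefore has length k; as alpha has no fixed
    points, k > 1, and since all alpha-cycles meeting this y-cycle have length
    divisible by k, they all have length exactly k. So alpha^k fixes the y-cycle
    pointwise, whence l | E^k - 1, and its l points lie on distinct alpha-cycles
    of length k, whence l < q(e, w). Thus every prime divisor of l divides
    E - 1, and since (E^k - 1)/(E - 1) is congruent to k modulo such primes and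
    gcd(l, k) = 1, in fact l | E - 1. *)
Require Import Defs.
From HB Require Import structures.
From mathcomp Require Import all_boot all_order all_algebra all_fingroup.
From mathcomp Require Import constructive_ereal cyclic.

Set Implicit Arguments.
Unset Strict Implicit.
Unset Printing Implicit Defensive.

Import Order.TTheory GRing.Theory Num.Theory.
Local Open Scope ring_scope.

(** * Orbit lengths and divisibility of E^k - 1 *)

Lemma expg_porbit_fix (T : finType) (s : {perm T}) (x : T) (i : nat) :
  ((s ^+ i)%g x == x) = (#|porbit s x| %| i)%N.
Proof.
have per k : (s ^+ (k * #|porbit s x|))%g x = x.
  elim: k => [|k IHk]; first by rewrite mul0n expg0 perm1.
  by rewrite mulSn addnC expgD permM IHk permX iter_porbit.
apply/eqP/idP => [|/dvdnP[k ->]]; last exact: per.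
rewrite {1}(divn_eq i #|porbit s x|) expgD permM per => Er.
have r_lt : (i %% #|porbit s x| < #|porbit s x|)%N.
  by rewrite ltn_pmod // lt0n card_porbit_neq0.
(* The trajectory of [x] has no repetition, yet it shows [x] both at position 0 and at the remainder
   of [i]; so the remainder is 0. *)
have := nth_uniq x (s := traject s x #|porbit s x|) (i := i %% #|porbit s x|)
          (j := 0%N).
rewrite size_traject uniq_traject_porbit !nth_traject //; last first.
  by rewrite lt0n card_porbit_neq0.
by rewrite -permX Er eqxx r_lt lt0n card_porbit_neq0 => /(_ isT isT isT) /esym.
Qed.

Lemma linear_cong_exists (l u c : nat) :
  (0 < l)%N -> (gcdn l u %| c)%N -> exists j, (l %| c + u * j)%N.
Proof.
move=> l_gt0 /dvdnP[z ->]; have [a _ a_dvd] := Bezoutl u l_gt0.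
exists (a * z)%N; rewrite mulnCA mulnA [X in (_ + X)%N]mulnC -mulnDr.
exact: dvdn_mull.
Qed.

Lemma eqn_mod_expn1 (d E k : nat) : (0 < E)%N -> (d %| E - 1)%N ->
  E ^ k = 1 %[mod d].
Proof.
move=> E_gt0 dE; rewrite -modnXm.
have /eqP-> : E == 1 %[mod d] by rewrite eqn_mod_dvd.
by rewrite modnXm exp1n.
Qed.

Lemma dvdn_expM_sub1 (E k m : nat) : (E ^ k - 1 %| E ^ (k * m) - 1)%N.
Proof. by rewrite expnM -{2}(exp1n m) subn_exp dvdn_mulr. Qed.

(* Modulo a prime dividing [E - 1], the cofactor [1 + E + ... + E ^ (k - 1)]
   of [E - 1] in [E ^ k - 1] is [k]. *)
Lemma dvdn_sub1_of_expn (l E k : nat) : (0 < E)%N ->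
  (l %| E ^ k - 1)%N -> coprime l k ->
  (forall p, prime p -> (p %| l)%N -> (p %| E - 1)%N) -> (l %| E - 1)%N.
Proof.
move=> E_gt0 lE lk lp; case: (posnP l) => [l0 | l_gt0].
  (* For [l = 0] coprimality forces [k = 1]. *)
  move: lk; rewrite l0 /coprime gcd0n => /eqP k1.
  by move: lE; rewrite l0 k1 expn1.
move: lE; rewrite -{1}(exp1n k) subn_exp mulnC Gauss_dvdr //.
rewrite /coprime -[_ == _]negbK; apply/negP=> g_neq1.
set S := (\sum_(_ < k) _)%N in g_neq1.
have g_gt1 : (1 < gcdn l S)%N by rewrite ltn_neqAle eq_sym g_neq1 gcdn_gt0 l_gt0.
have := pdiv_dvd (gcdn l S); set p := pdiv _; rewrite dvdn_gcd => /andP[pl pS].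
have p_pr : prime p := pdiv_prime g_gt1.
have pk : (p %| k)%N.
  suff -> : (p %| k)%N = (p %| S)%N by [].
  rewrite /dvdn /S -{1}(card_ord k) -sum1_card.
  rewrite -[in LHS]modn_summ -[in RHS]modn_summ; congr (_ %% _ == _)%N.
  apply: eq_bigr => i _; rewrite exp1n muln1.
  by rewrite (@eqn_mod_expn1 p E) ?lp.
have := coprime_dvdl pl (coprime_dvdr pk lk).
by rewrite /coprime gcdnn => /eqP p1; rewrite p1 in p_pr.
Qed.

(** * Permutations that alpha conjugates to a power *)

Section Twist.

Variables (T : finType) (alpha y : {perm T}) (E : nat).
Hypothesis yE : (y ^ alpha = y ^+ E)%g.

Lemma twist_expg (t j : nat) (x : T) :
  (alpha ^+ t)%g ((y ^+ j)%g x) = (y ^+ (E ^ t * j))%g ((alpha ^+ t)%g x).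
Proof.
rewrite -!permM; congr (fun_of_perm _ x).
have -> : (y ^+ (E ^ t * j) = (y ^+ j) ^ (alpha ^+ t))%g.
  rewrite conjXg expgM; congr (_ ^+ _)%g.
  elim: t => [|t IHt]; first by rewrite expg0 conjg1.
  by rewrite expgSr conjgM -IHt conjXg yE -expgM -expnS.
by rewrite conjgC.
Qed.

Lemma twist_porbit (t : nat) (x x' : T) : x' \in porbit y x ->
  porbit y ((alpha ^+ t)%g x') = porbit y ((alpha ^+ t)%g x).
Proof. by case/porbitP=> j ->; rewrite twist_expg porbit_perm. Qed.

Hypothesis E_gt0 : (0 < E)%N.
Hypothesis alpha_cop :
  forall x, coprime #|porbit alpha x| (E ^ #|porbit alpha x| - 1)%N.

(* [alpha ^ k] acts on the orbit as an affine map [m |-> E ^ k * m + c] of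
   Z/lZ; iterating it until [x] returns forces [gcd(l, E ^ k - 1) | c], and
   this is what is needed for the fixed point equation to be solvable. *)
Lemma twist_fixpoint (k : nat) (x : T) :
    (k %| #|porbit alpha x|)%N -> (alpha ^+ k)%g x \in porbit y x ->
  exists2 x', x' \in porbit y x & (alpha ^+ k)%g x' = x'.
Proof.
set l := #|porbit y x|; move=> /dvdnP[b ab] /porbitP[c xc].
have l_gt0 : (0 < l)%N by rewrite lt0n card_porbit_neq0.
pose d := gcdn l (E ^ k - 1).
have Ek_gt0 : (0 < E ^ k)%N by rewrite expn_gt0 E_gt0.
have Ekd : (E ^ k == 1 %[mod d])%N by rewrite eqn_mod_dvd // dvdn_gcdr.
(* The exponent is c(1 + E^k + ... + E^(k(i-1))), and E^k is 1 modulo [d]. *)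
have step i : exists2 m, (alpha ^+ (k * i))%g x = (y ^+ m)%g x
    & m = (i * c)%N %[mod d].
  elim: i => [|i [m xm mc]]; first by exists 0%N; rewrite // muln0 !expg0.
  exists (c + E ^ k * m)%N.
    by rewrite mulnS addnC expgD permM xm twist_expg xc -permM -expgD.
  by rewrite mulSn -modnDmr -modnMm (eqP Ekd) mc modnMm mul1n modnDmr.
(* After [b] iterations [x] returns, so [d] divides [b * c]. Since [b] divides the cycle length a =
   bk and [d] divides E^a - 1, [d] is coprime to [b]. *)
have d_dvd : (d %| c)%N.
  have [m xm mc] := step b.
  have : (l %| m)%N.
    by rewrite -expg_porbit_fix -xm mulnC -ab permX iter_porbit.
  move/(dvdn_trans (dvdn_gcdl l (E ^ k - 1))) => d_m.
  have dbc : (d %| b * c)%N by rewrite /dvdn -mc.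
  rewrite -(@Gauss_dvdr d b) // coprime_sym.
  apply: coprime_dvdl (coprime_dvdr _ (alpha_cop x)).
    by rewrite ab dvdn_mulr.
  by rewrite ab mulnC (dvdn_trans (dvdn_gcdr _ _)) ?dvdn_expM_sub1.
(* The exponent [j] solves E^k j + c = j modulo [l]. *)
have [j lj] := linear_cong_exists l_gt0 d_dvd.
exists ((y ^+ j)%g x); first exact: mem_porbit.
rewrite twist_expg xc -permM -expgD -(subnK Ek_gt0) mulnDl mul1n addnA.
rewrite expgD permM; congr (fun_of_perm _ _).
by apply/eqP; rewrite expg_porbit_fix.
Qed.

Hypothesis alpha_nofix : forall x, alpha x != x.
Hypothesis alpha_len : forall x x', #|porbit alpha x| <> #|porbit alpha x'| ->
  coprime #|porbit alpha x| #|porbit alpha x'|.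

(** Here [k] is the least positive exponent for which alpha^k stabilizes the y-orbit of [x]; the
    stabilizing exponents are closed under addition and remainder, hence are the multiples of
    [k]. *)
Lemma twist_blocks (x : T) : exists k, [/\ (0 < k)%N,
  forall t x1 x2, x1 \in porbit y x -> x2 \in porbit y x ->
    (alpha ^+ t)%g x1 = x2 -> (k %| t)%N
  & forall x', x' \in porbit y x -> #|porbit alpha x'| = k].
Proof.
pose P t := porbit y ((alpha ^+ t)%g x) == porbit y x.
have PD t u : P t -> P (t + u)%N = P u.
  rewrite /P eq_porbit_mem => Pt.
  by rewrite expgD permM (twist_porbit _ Pt).
have Pmem t x1 x2 : x1 \in porbit y x -> x2 \in porbit y x ->
    (alpha ^+ t)%g x1 = x2 -> P t.
  move=> yx1 yx2 E12.
  by rewrite /P -(twist_porbit t yx1) E12 eq_porbit_mem.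
have Plen x' : x' \in porbit y x -> P #|porbit alpha x'|.
  by move=> yx'; apply: (Pmem _ x' x') => //; rewrite permX iter_porbit.
have exP : exists t, (0 < t)%N && P t.
  exists #|porbit alpha x|; rewrite lt0n card_porbit_neq0.
  exact: Plen (porbit_id _ _).
case: (ex_minnP exP) => k /andP[k_gt0 Pk] k_min.
have Pdvd t : P t -> (k %| t)%N.
  have PM q : P (q * k)%N.
    elim: q => [|q IHq]; first by rewrite /P expg0 perm1.
    by rewrite mulSn PD.
  rewrite (divn_eq t k) PD // => Pr.
  rewrite dvdn_addr ?dvdn_mull //; have := ltn_pmod t k_gt0.
  by case: (posnP (t %% k)) => [-> // | r_gt0]; rewrite ltnNge k_min ?r_gt0.
have len_dvd x' : x' \in porbit y x -> (k %| #|porbit alpha x'|)%N.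
  by move/Plen/Pdvd.
have [x0 yx0 fx0] : exists2 x', x' \in porbit y x & (alpha ^+ k)%g x' = x'.
  apply: twist_fixpoint; first exact: len_dvd (porbit_id _ _).
  by rewrite -eq_porbit_mem.
have len_x0 : #|porbit alpha x0| = k.
  apply/eqP; rewrite eqn_dvd len_dvd // andbT -expg_porbit_fix.
  exact/eqP.
exists k; split=> // [t x1 x2 yx1 yx2 E12 | x' yx'].
  exact: Pdvd (Pmem _ _ _ yx1 yx2 E12).
(* A different length would be both coprime to [k] and a multiple of it, so [k = 1] and alpha would
   fix [x0]. *)
case: (eqVneq #|porbit alpha x'| k) => // neq_k.
have := alpha_len (x := x0) (x' := x'); rewrite len_x0 => len_cop.
have : coprime k #|porbit alpha x'|.
  by apply: len_cop => /esym/eqP; rewrite (negPf neq_k).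
rewrite /coprime (gcdn_idPl (len_dvd _ yx')) => k1.
have := alpha_nofix x0.
by rewrite -{1}[alpha]expg1 -(eqP k1) fx0 eqxx.
Qed.

(** The bound on [p] makes the condition transferable from e to E, which agree only modulo a
    multiple of n!. *)
Hypothesis alpha_num : forall p x, prime p -> (p <= #|T|)%N ->
  (p %| E ^ #[alpha]%g - 1)%N -> ~~ (p %| E - 1)%N ->
  (#|[set c in porbits alpha | #|c| == #|porbit alpha x| ]| < p)%N.

Lemma twist_porbit_dvdn (x : T) : (#|porbit y x| %| E - 1)%N.
Proof.
have [k [k_gt0 k_dvd k_len]] := twist_blocks x.
set l := #|porbit y x|.
have alphak x' : x' \in porbit y x -> (alpha ^+ k)%g x' = x'.
  by move=> yx'; apply/eqP; rewrite expg_porbit_fix k_len.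
have lE : (l %| E ^ k - 1)%N.
  rewrite -expg_porbit_fix.
  (* Evaluate alpha^k at y(x) in two ways: it is y(x), and also y^(E^k) applied to x. *)
  have := alphak _ (mem_porbit y 1 x).
  rewrite twist_expg muln1 alphak ?porbit_id //.
  have Ek_gt0 : (0 < E ^ k)%N by rewrite expn_gt0 E_gt0.
  rewrite -[in LHS](subnK Ek_gt0) expgD permM => /perm_inj.
  by move/eqP.
have l_num : (l <= #|[set c in porbits alpha | #|c| == k]|)%N.
  (* If alpha^t maps one point of the y-orbit to another, then [k] divides [t], so alpha^t fixes the
     first and the two coincide. *)
  have <- : #|porbit alpha @: porbit y x| = l.
    apply: card_in_imset => x1 x2 yx1 yx2 /esym/eqP.
    rewrite eq_porbit_mem => /porbitP[t E12].
    rewrite E12; apply/esym/eqP; rewrite expg_porbit_fix k_len //.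
    exact: k_dvd yx1 yx2 (esym E12).
  apply: subset_leq_card; apply/subsetP=> _ /imsetP[x' yx' ->].
  by rewrite inE k_len // eqxx andbT imset_f.
have k_alpha : (k %| #[alpha]%g)%N.
  by rewrite -(k_len x) ?porbit_id // -expg_porbit_fix expg_order perm1.
have lp p : prime p -> (p %| l)%N -> (p %| E - 1)%N.
  move=> p_pr pl; apply: contraTT (l_num) => pE.
  have l_gt0 : (0 < l)%N by rewrite lt0n card_porbit_neq0.
  have p_le := dvdn_leq l_gt0 pl.
  rewrite -ltnNge; apply: leq_trans p_le.
  rewrite -(k_len x) ?porbit_id //; apply: alpha_num => //.
    exact: leq_trans (dvdn_leq l_gt0 pl) (max_card _).
  apply: dvdn_trans pl (dvdn_trans lE _).
  by case/dvdnP: k_alpha => b ->; rewrite mulnC dvdn_expM_sub1.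
apply: (dvdn_sub1_of_expn _ lE) => //; rewrite coprime_sym.
by apply: (coprime_dvdr lE); rewrite -(k_len x) ?porbit_id ?alpha_cop.
Qed.

Lemma twist_expg_sub1 : (y ^+ (E - 1) = 1)%g.
Proof.
apply/permP=> x; rewrite perm1; apply/eqP.
by rewrite expg_porbit_fix twist_porbit_dvdn.
Qed.

End Twist.

(** * Passing from the integer e to a natural exponent *)

Lemma expgz_expgn (gT : finGroupType) (x : gT) (k : int) (m : nat) :
  (#[x]%g%:Z %| k - m%:Z)%Z -> expgz x k = (x ^+ m)%g.
Proof.
case: k => k /= x_dvd.
  by apply/eqP; rewrite eq_expg_mod_order -eqz_nat -!modz_nat eqz_mod_dvd.
apply/eqP; rewrite eq_sym eq_mulgV1 invgK -expgD -order_dvdn addnC.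
by move: x_dvd; rewrite NegzE -opprD dvdzE abszN -PoszD.
Qed.

Lemma dvdz_expn_sub1 (e : int) (E d k : nat) : (0 < E)%N ->
  (d%:Z %| e - E%:Z)%Z ->
  (d %| E ^ k - 1)%N = (d%:Z %| e ^+ k - 1)%Z.
Proof.
move=> E_gt0 deE.
have -> : e ^+ k - 1 = (e ^+ k - E%:Z ^+ k) + (E ^ k - 1)%N%:Z.
  by rewrite -subzn ?expn_gt0 ?E_gt0 // -[(E ^ k)%N%:Z]natz natrX natz addrA subrK.
by rewrite rpredDl // subrXX dvdz_mulr.
Qed.

Lemma minprime_le (e : int) (v p : nat) : e ^+ v != 1 -> prime p ->
  (p%:Z %| e ^+ v - 1)%Z -> ~~ (p%:Z %| e - 1)%Z ->
  (minprime e v <= (p%:Z)%:E)%E.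
Proof.
move=> ev_neq1 p_pr pev pe; apply: ge_bigmin_seq => //.
by rewrite mem_primes p_pr absz_gt0 subr_eq0 ev_neq1.
Qed.

Lemma expz_neq1 (e : int) (v : nat) : e \notin [:: -1; 0; 1] -> (0 < v)%N ->
  e ^+ v != 1.
Proof.
move=> he v_gt0; apply/eqP => /(congr1 absz); rewrite abszX => /eqP.
rewrite absz1 -(exp1n v) eqn_exp2r // => e1.
by move: he; rewrite !inE !negb_or => /and3P[]; case: (e) e1 => [[|[|m]]|[|m]].
Qed.

Lemma ncycles_porbit_neq0 (n : nat) (s : 'S_n) (x : 'I_n) :
  ncycles s #|porbit s x| <> 0%N.
Proof.
apply/eqP; rewrite cards_eq0; apply/set0Pn; exists (porbit s x).
by rewrite inE eqxx imset_f.
Qed.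

Theorem theorem2p14 (e : int) (n : nat) (alpha : 'S_n) (w : nat)
  (he : e \notin [:: -1; 0; 1])
  (hg1 : ncycles alpha 1 = 0%N)
  (hcop : forall a b : nat, (1 <= a)%N -> (a < b)%N -> (b <= n)%N ->
     ncycles alpha a <> 0%N -> ncycles alpha b <> 0%N -> coprime a b)
  (hw : w = #[alpha]%g)
  (hq : forall a : nat, (1 <= a <= n)%N -> ncycles alpha a <> 0%N ->
     [/\ (1 <= ncycles alpha a)%N,
         ((ncycles alpha a)%:Z%:E <= minprime e w - 1%:E)%E
       & coprimez a (e ^+ a - 1)])
  (y : 'S_n) :
  (alpha \o y \o (alpha^-1)%g =1 expgz y e ->
     expgz y (e - 1) = 1%g /\ alpha \o y =1 y \o alpha)
  /\ (expgz y (e - 1) = 1%g /\ alpha \o y =1 y \o alpha ->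
     alpha \o y \o (alpha^-1)%g =1 expgz y e).
Proof.
have len_bound x : (1 <= #|porbit alpha x| <= n)%N.
  by rewrite lt0n card_porbit_neq0 -[leqRHS]card_ord max_card.
(* The factor n! covers all cycle lengths and all primes up to n; the order of [y] gives y^e =
   y^E. *)
pose N := (n`! * #[y]%g)%N.
have N_gt0 : (0 < N)%N by rewrite muln_gt0 fact_gt0 order_gt0.
have [E E_gt0 NeE] : exists2 E, (0 < E)%N & (N%:Z %| e - E%:Z)%Z.
  (* Adding [N] keeps [E] positive when [N] divides [e]. *)
  exists (`|(e %% N)%Z| + N)%N; first by rewrite addn_gt0 N_gt0 orbT.
  rewrite PoszD gez0_abs ?modz_ge0 ?gt_eqF // opprD addrA.
  by rewrite {1}(divz_eq e N) addrK rpredB ?dvdz_mull.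
have eE d : (d %| N)%N -> (d%:Z %| e - E%:Z)%Z by move=> dN; apply: dvdz_trans NeE.
have small d : (0 < d <= n)%N -> (d %| N)%N by move=> /dvdn_fact ?; rewrite dvdn_mulr.
have ye : expgz y e = (y ^+ E)%g by rewrite (@expgz_expgn _ _ _ E) ?eE ?dvdn_mull.
have ye1 : expgz y (e - 1) = (y ^+ (E - 1))%g.
  apply: expgz_expgn; rewrite -subzn // opprB addrA subrK.
  by rewrite eE ?dvdn_mull.
have comm : (y ^+ (E - 1) = 1)%g -> (y ^+ E = y)%g.
  by move=> yE1; rewrite -(subnK E_gt0) expgD yE1 mul1g expg1.
rewrite ye1 ye; split=> [twist | [yE1 comm_y] x]; last first.
  by rewrite comm //= [LHS]comm_y /= permKV.
have yE1 : (y ^+ (E - 1) = 1)%g.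
  apply: (@twist_expg_sub1 _ alpha y E) => //.
  (* Products of permutations act from left to right, so [y ^ alpha] is the function alpha o y o
     alpha^-1. *)
  - apply/permP=> x; rewrite !permM /=.
    by have := twist x; rewrite /= => ->.
  - move=> x; have [_ _ cop] := hq _ (len_bound x) (@ncycles_porbit_neq0 _ _ x).
    set a := #|_| in cop *.
    (* As [d] divides a cycle length, it divides [N], so [e] may replace [E] modulo [d]. *)
    rewrite /coprime eqn_dvd dvd1n andbT; set d := gcdn _ _.
    have da : (d %| a)%N := dvdn_gcdl _ _.
    have dN : (d %| N)%N := dvdn_trans da (small _ (len_bound x)).
    have := dvdn_gcdr a (E ^ a - 1); rewrite -/d.
    rewrite (@dvdz_expn_sub1 e) // ?eE // => de.
    have : (d%:Z %| gcdz a (e ^+ a - 1))%Z by rewrite dvdz_gcd de andbT.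
    by rewrite (eqP cop).
  - move=> x; apply/eqP => fx; have := @ncycles_porbit_neq0 _ alpha x.
    suff -> : #|porbit alpha x| = 1%N by [].
    by apply/eqP; rewrite -dvdn1 -expg_porbit_fix expg1 fx.
  - move=> x x' /eqP; rewrite neq_ltn => /orP[] lt_len.
      apply: hcop lt_len _ _ _; try exact: ncycles_porbit_neq0.
        by case/andP: (len_bound x).
      by case/andP: (len_bound x').
    rewrite coprime_sym; apply: hcop lt_len _ _ _; try exact: ncycles_porbit_neq0.
      by case/andP: (len_bound x').
    by case/andP: (len_bound x).
  - move=> p x p_pr; rewrite card_ord => p_le.
    have pN : (p %| N)%N by rewrite small ?prime_gt0.
    rewrite -{2}(expn1 E) !(@dvdz_expn_sub1 e) ?eE // expr1 -hw => pw pe.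
    have [_ g_le _] := hq _ (len_bound x) (@ncycles_porbit_neq0 _ _ x).
    have w_gt0 : (0 < w)%N by rewrite hw order_gt0.
    have := minprime_le (expz_neq1 he w_gt0) p_pr pw pe.
    (* The value +oo contradicts the bound by [p], and -oo contradicts the bound on the cycle
       count. *)
    move: g_le; rewrite -/(ncycles _ _); case: (minprime e w) => [q| |] //=.
    rewrite -EFinB !lee_fin => g_le q_le.
    by rewrite -ltz_nat; apply: lt_le_trans q_le; rewrite -lezD1 -lerBrDr.
split=> // x; have := twist (alpha x).
by rewrite /= permK comm.
Qed.
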